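(* Let $n,k\ge 1$ be integers and let $W=(w_{ij})_{1\le i,j\le n}$ be an $n\times n$ complex Hermitian random matrix with the invariance property that $UWU^*$ has the same distribution as $W$ for any unitary $n\times n$ matrix $U$. For any two sequences $\mathbf{i}=(i_1,\dots,i_k)$ and $\mathbf{j}=(j_1,\dots,j_k)$ of elements of $\{1,\dots,n\}$, $$E[w_{i_1 j_1} w_{i_2 j_2}\cdots w_{i_k j_k}]=\sum_{\sigma,\tau\in S_k}\delta_\sigma(\mathbf{i},\mathbf{j})\,\mathrm{Wg}^{\mathrm U}(\sigma^{-1}\tau;n)\,E[\mathrm{Tr}_\tau(W)].$$
   Context: $S_k$ is the symmetric group on $\{1,\dots,k\}$. For $\pi\in S_k$, $\kappa(\pi)$ is the number of cycles of $\pi$ (fixed points included), and the cycle-type of $\pi$ is the partition $\mu=(\mu_1,\dots,\mu_l)$ of $k$ formed by its cycle lengths in weakly decreasing order. For sequences $\mathbf{i}=(i_1,\dots,i_k)$, $\mathbf{i}'=(i_1',\dots,i_k')$ and $\pi\in S_k$, put $\delta_\pi(\mathbf{i},\mathbf{i}')=\prod_{s=1}^k\delta_{i_{\pi(s)},i'_s}$ (Kronecker deltas). For a square matrix $A$ and $\pi\in S_k$ of cycle-type $(\mu_1,\dots,\mu_l)$, put $\mathrm{Tr}_\pi(A)=\prod_{j=1}^l\mathrm{Tr}(A^{\mu_j})$. Functions on $S_k$ are multiplied by convolution $(f_1*f_2)(\pi)=\sum_{\tau\in S_k}f_1(\tau)f_2(\tau^{-1}\pi)$. For $z\in\mathbb{C}$,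 the unitary Weingarten function $\mathrm{Wg}^{\mathrm U}(\cdot;z)$ on $S_k$ is the pseudo-inverse of the central function $z^{\kappa(\cdot)}:\pi\mapsto z^{\kappa(\pi)}$, i.e. the unique class function satisfying $z^{\kappa(\cdot)}*\mathrm{Wg}^{\mathrm U}(\cdot;z)*z^{\kappa(\cdot)}=z^{\kappa(\cdot)}$ and $\mathrm{Wg}^{\mathrm U}(\cdot;z)*z^{\kappa(\cdot)}*\mathrm{Wg}^{\mathrm U}(\cdot;z)=\mathrm{Wg}^{\mathrm U}(\cdot;z)$. Equivalently, $$\mathrm{Wg}^{\mathrm U}(\pi;z)=\frac1{k!}\sum_{\lambda\vdash k,\ C_\lambda(z)\ne0}\frac{f^\lambda}{C_\lambda(z)}\chi^\lambda(\pi),\qquad C_\lambda(z)=\prod_{i=1}^{\ell(\lambda)}\prod_{j=1}^{\lambda_i}(z+j-i),$$ where $\chi^\lambda$ is the irreducible character of $S_k$ indexed by the partition $\lambda$ of $k$, $\ell(\lambda)$ is the length of $\lambda$, and $f^\lambda=\chi^\lambda(e)$ with $e$ the identity permutation. *)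

(* Defs.v *)
From HB Require Import structures.
From mathcomp Require Import all_boot all_order all_algebra all_fingroup.
From mathcomp Require Import all_classical all_reals all_analysis.
From mathcomp Require Import complex.

Set Implicit Arguments.
Unset Strict Implicit.
Unset Printing Implicit Defensive.

Import Order.TTheory GRing.Theory Num.Theory.

Local Open Scope classical_set_scope.
Local Open Scope ring_scope.
Local Open Scope complex_scope.
Local Open Scope sesquilinear_scope.

Definition complex_display : measure_display.
Proof. exact: default_measure_display. Qed.

Definition mx_display : measure_display -> measure_display.
Proof. exact. Qed.

HB.instance Definition _ (R : realType) := isPointed.Build R[i] 0.

(* The sigma-algebra of R x R, transported to R[i]: it is generated by the
   sets Re^-1(B) and Im^-1(B) with B Borel in R. *)
Definition complex_measurable (R : realType) : set (set R[i]) :=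
  g_sigma_preimageU (@complex.Re R) (@complex.Im R).

HB.instance Definition _ (R : realType) :=
  @isMeasurable.Build complex_display R[i] (@complex_measurable R)
    (@sigma_algebra0 _ setT _) (@sigma_algebraC _ _)
    (@sigma_algebra_bigcup _ setT _).

Definition mx_measurable d (T : measurableType d) (m n : nat) :
    set (set 'M[T]_(m, n)) :=
  <<s [set A | exists i j, preimage_set_system [set: 'M[T]_(m, n)]
                 (fun M : 'M[T]_(m, n) => M i j) measurable A] >>.

HB.instance Definition _ d (T : measurableType d) (m n : nat) :=
  @isMeasurable.Build (mx_display d) 'M[T]_(m, n) (@mx_measurable d T m n)
    (@sigma_algebra0 _ setT _) (@sigma_algebraC _ _)
    (@sigma_algebra_bigcup _ setT _).

(* Meaningful when X is integrable; [fine] sends infinite values to 0. *)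
Definition cexpectation d (T : measurableType d) (R : realType)
    (P : probability T R) (X : T -> R[i]) : R[i] :=
  fine ('E_P[fun t => complex.Re (X t)])%E +i*
  fine ('E_P[fun t => complex.Im (X t)])%E.

Definition unitarily_invariant d (T : measurableType d) (R : realType)
    (P : probability T R) (n : nat) (W : {RV P >-> 'M[R[i]]_n}) : Prop :=
  forall U : 'M[R[i]]_n, U \is unitarymx ->
  forall A : set 'M[R[i]]_n, measurable A ->
    pushforward P (fun t => U *m W t *m U^t*) A = distribution P W A.

(* Exactly what makes E[w_(i_1 j_1) ... w_(i_k j_k)] exist for all index
   sequences of length k: constant sequences give necessity, Hoelder's
   inequality sufficiency. E[Tr_tau(W)] then exists as well. *)
Definition finite_entry_moments d (T : measurableType d) (R : realType)
    (P : probability T R) (n : nat) (W : {RV P >-> 'M[R[i]]_n}) (k : nat) :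
    Prop :=
  forall a b : 'I_n, ('E_P[fun t => (Normc.normc (W t a b) ^+ k)%R] < +oo)%E.

(* MathComp multiplies permutations left to right, (s * t) x = t (s x): the
   composite written s t in the functional convention is [(t * s)%g]. *)

Definition kappa k (s : 'S_k) : nat := #|porbits s|.

Definition cycle_type k (s : 'S_k) : seq nat :=
  sort geq [seq #|pred_of_set c| | c <- enum (porbits s)].

Definition delta_perm (R : realType) k n (s : 'S_k) (i j : 'I_k -> 'I_n) :
    R[i] :=
  \prod_(r < k) (i (s r) == j r)%:R.

Definition Tr_perm (R : realType) k n (s : 'S_k) (A : 'M[R[i]]_n) : R[i] :=
  \prod_(m <- cycle_type s) \tr (A ^+ m).

Definition convolution (R : realType) k (f g : {ffun 'S_k -> R[i]}) :
    {ffun 'S_k -> R[i]} :=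
  [ffun s : 'S_k => \sum_(t : 'S_k) f t * g (s * t^-1)%g].

Definition class_function (R : realType) k (f : {ffun 'S_k -> R[i]}) : Prop :=
  forall s t : 'S_k, f (s ^ t)%g = f s.

Definition pow_kappa (R : realType) k (z : R[i]) : {ffun 'S_k -> R[i]} :=
  [ffun s : 'S_k => z ^+ kappa s].

Definition is_WgU (R : realType) k (z : R[i]) (f : {ffun 'S_k -> R[i]}) :
    Prop :=
  let g := pow_kappa k z in
  [/\ class_function f,
      convolution (convolution g f) g = g
    & convolution (convolution f g) f = f].

(* Class functions form a commutative ring under convolution, in which a
   pseudo-inverse is unique, so [xget] picks the only candidate. *)
Definition WgU (R : realType) k (z : R[i]) : {ffun 'S_k -> R[i]} :=
  xget 0 [set f | is_WgU z f].

(* Main.v *)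
(* The tensor T(a, b) = E[w_(a_1 b_1) ... w_(a_k b_k)] commutes with U^(x)k for
   every unitary U.  Commuting with diagonal unitaries forces T(a, b) = 0 unless
   a and b have the same content, hence T commutes with D^(x)k for all diagonal
   D, with X^(x)k for all normal X (spectral theorem) and, by polarization of
   hermitian matrices, with every S_k-invariant operator.

   Put p(X)(a, b) = sum_(sigma, tau) delta_sigma(a, b) Wg(sigma^-1 tau)
   sum_c X(c, c o tau).  Column b of p(X) is sum_d K_(b,d) X_(., d) with
   S_k-invariant kernels K_(b,d), so p(T) = T p(1).  The pseudo-inverse equation
   for Wg says that p(1) - 1, which is a combination of permutation operators,
   is orthogonal to all of them, so p(1) = 1.  Thus T = p(T), and
   sum_c T(c, c o tau) = E[Tr_tau(W)]. *)

Require Import Defs.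
From HB Require Import structures.
From mathcomp Require Import all_boot all_order all_algebra all_fingroup.
From mathcomp Require Import all_classical all_reals all_analysis.
From mathcomp Require Import complex.
From mathcomp Require Import measurable_realfun ring.

Set Implicit Arguments.
Unset Strict Implicit.
Unset Printing Implicit Defensive.

Import Order.TTheory GRing.Theory Num.Theory.

Local Open Scope ring_scope.

(** * Traces of matrix powers as sums over closed walks *)

Section Traces.
Variables (C : comNzRingType) (n : nat).
Implicit Types (A : 'M[C]_n) (a b : 'I_n).

(** The list [w] holds interior vertices only, so a path has one edge more than [w] has letters. *)
Fixpoint walk A a (w : seq 'I_n) b : C :=
  if w is c :: w' then A a c * walk A c w' b else A a b.

Lemma mx_exp_walk A m a b :
  (A ^+ m.+1) a b = \sum_(w : m.-tuple 'I_n) walk A a w b.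
Proof.
elim: m a => [|m IHm] a.
  rewrite expr1 (bigD1 [tuple]) //= big1 ?addr0 // => w.
  by rewrite tuple0.
rewrite exprS mxE.
rewrite (reindex (fun p : 'I_n * m.-tuple 'I_n => [tuple of p.1 :: p.2])) /=.
  rewrite -(pair_bigA _ (fun c (w : m.-tuple 'I_n) => A a c * walk A c w b)) /=.
  by apply: eq_bigr => c _; rewrite IHm mulr_sumr.
exists (fun w : m.+1.-tuple 'I_n => (thead w, [tuple of behead w])) => /=.
  by case=> c w _ /=; congr (_, _); apply: val_inj.
by move=> w _; rewrite -tuple_eta.
Qed.

Lemma trace_exp_walk A m :
  \tr (A ^+ m.+1) =
  \sum_(w : m.+1.-tuple 'I_n) walk A (thead w) (behead w) (thead w).
Proof.
rewrite /mxtrace.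
rewrite (reindex (fun p : 'I_n * m.-tuple 'I_n => [tuple of p.1 :: p.2])) /=.
  rewrite -(pair_bigA _ (fun c (w : m.-tuple 'I_n) =>
    walk A (thead [tuple of c :: w]) w (thead [tuple of c :: w]))) /=.
  by apply: eq_bigr => c _; rewrite mx_exp_walk.
exists (fun w : m.+1.-tuple 'I_n => (thead w, [tuple of behead w])) => /=.
  by case=> c w _ /=; congr (_, _); apply: val_inj.
by move=> w _; rewrite -tuple_eta.
Qed.

Variables (X : finType) (s : {perm X}).

Lemma walk_traject A (g : X -> 'I_n) x m :
  \prod_(r <- traject s x m.+1) A (g r) (g (s r)) =
  walk A (g x) (map g (traject s (s x) m)) (g (iter m s (s x))).
Proof.
elim: m x => [|m IHm] x; first by rewrite big_seq1.
by rewrite trajectS big_cons IHm iterSr.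
Qed.

(** Going once around the cycle of [x], a closed walk is a labelling [g] of its points, the edge at
    [r] leading to [s r]. Labellings are total functions with value [c0] off the orbit, the form in
    which a product over orbits can be distributed. *)
Lemma trace_porbit (c0 : 'I_n) A x :
  \tr (A ^+ #|porbit s x|) =
  \sum_(g in pffun_on c0 (mem (porbit s x)) predT)
    \prod_(r in porbit s x) A (g r) (g (s r)).
Proof.
have [m cardE] : exists m, #|porbit s x| = m.+1.
  by exists #|porbit s x|.-1; rewrite prednK // lt0n card_porbit_neq0.
have [t tE] : exists t, t = traject s x m.+1 by exists (traject s x m.+1).
have memt y : (y \in t) = (y \in porbit s x) by rewrite porbit_traject cardE tE.
have tU : uniq t by rewrite tE -cardE uniq_traject_porbit.
have szt : size t = m.+1 by rewrite tE size_traject.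
have szgt (g : X -> 'I_n) : size (map g t) == m.+1 by rewrite size_map szt.
rewrite cardE trace_exp_walk.
(* Labels are read along the trajectory [t] of [x]; the inverse looks a point up by its position in
   [t]. *)
rewrite (reindex_onto (fun g : {ffun X -> 'I_n} => Tuple (szgt g))
  (fun w : m.+1.-tuple 'I_n =>
     [ffun r => if r \in t then nth c0 w (index r t) else c0])) /=; last first.
  move=> w _; apply: val_inj => /=.
  apply: (@eq_from_nth _ c0); first by rewrite size_map szt size_tuple.
  move=> i; rewrite size_map => it.
  by rewrite (nth_map x) // ffunE mem_nth // index_uniq.
apply: eq_big => [g|g _].
  apply/eqP/pffun_onP => [<-|[supp _]].
    split=> //; apply/fintype.subsetP => r; rewrite -memt supportE ffunE.
    by case: ifP => // _; rewrite eqxx.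
  apply/ffunP => r; rewrite ffunE memt; case: ifP => rt.
    by rewrite (nth_map x) ?index_mem ?memt // nth_index ?memt.
  apply/esym/eqP; apply: contraFT rt => gr.
  by apply: (fintype.subsetP supp); rewrite supportE.
rewrite (eq_bigl (fun r => r \in t)) => [|r]; last by rewrite memt.
rewrite -big_uniq // /thead (tnth_nth c0) /= tE walk_traject /=.
(* The walk closes up: [m.+1] steps of [s] bring [x] back to itself. *)
congr (walk _ _ _ (g _)).
by rewrite -iterSr -cardE (iter_porbit s x).
Qed.

(** Distributing the product over the orbits gives families of labellings, one per orbit; as the
    orbits partition [X], such a family is a single labelling of [X]. *)
Lemma trace_perm_prod (c0 : 'I_n) A :
  \prod_(B in porbits s) \tr (A ^+ #|B|) =
  \sum_(c : {ffun X -> 'I_n}) \prod_r A (c r) (c (s r)).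
Proof.
pose c00 : {ffun X -> 'I_n} := [ffun=> c0].
rewrite (eq_bigr (fun B : {set X} =>
   \sum_(g in pffun_on c0 (mem B) predT) \prod_(r in B) A (g r) (g (s r)))); last first.
  by move=> B /imsetP[x _ ->]; exact: trace_porbit.
rewrite (big_distr_big_dep c00) /=.
rewrite (reindex_onto (fun c : {ffun X -> 'I_n} =>
    [ffun B : {set X} => if B \in porbits s then
       [ffun r => if r \in B then c r else c0] else c00])
  (fun f : {ffun {set X} -> {ffun X -> 'I_n}} => [ffun r => f (porbit s r) r])) /=; last first.
  move=> f /pfamilyP[/= suppf Hf]; apply/ffunP => B; rewrite ffunE.
  case: ifPn => BP; last first.
    apply/esym/eqP; apply: contraNT BP => fB.
    by apply: (fintype.subsetP suppf); rewrite supportE.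
  have /pffun_onP[supp _] := Hf B BP.
  apply/ffunP => r; rewrite !ffunE; case: ifPn => rB; last first.
    by apply/esym/eqP; apply: contraNT rB => fr; apply: (fintype.subsetP supp); rewrite supportE.
  have [x _ defB] := imsetP BP.
  by move: rB; rewrite defB -eq_porbit_mem => /eqP->.
apply: eq_big => [c|c _].
  apply/andP; split; last first.
    apply/eqP/ffunP => r; rewrite !ffunE.
    by rewrite imset_f // ffunE porbit_id.
  apply/pfamilyP; split=> [|B BP]; first (apply/fintype.subsetP => B).
    by rewrite supportE ffunE; case: ifP => //; rewrite eqxx.
  rewrite ffunE BP; apply/pffun_onP; split=> //; apply/fintype.subsetP => r.
  by rewrite supportE ffunE; case: ifP => //; rewrite eqxx.
rewrite (partition_big (porbit s) (mem (porbits s))) /=; last first.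
  by move=> r _; apply: imset_f.
apply: eq_bigr => B BP; have [x _ defB] := imsetP BP.
apply: eq_big => [r|r rB]; first by rewrite defB porbit_sym -eq_porbit_mem eq_sym.
rewrite ffunE BP !ffunE rB.
(* Orbits are stable under [s], so the label of [s r] is not the default [c0]. *)
suff -> : s r \in B by [].
by move: rB; rewrite defB -!eq_porbit_mem; have := porbit_perm s 1 r; rewrite expg1 => ->.
Qed.
End Traces.

(** Passes from cycle types to multi-indices: [Tr_perm] is a contraction of the k-th tensor power of
    [A] along [s]. Sorting only reorders the factors, and [hn] provides the default label. *)
Lemma Tr_permE (R : realType) k n (hn : (0 < n)%N) (s : 'S_k) (A : 'M[R[i]]_n) :
  Tr_perm s A = \sum_(c : {ffun 'I_k -> 'I_n}) \prod_r A (c r) (c (s r)).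
Proof.
rewrite -(trace_perm_prod s (Ordinal hn)) /Tr_perm /cycle_type.
by rewrite (perm_big _ (permEl (perm_sort _ _))) big_map big_enum.
Qed.

(** * Pseudo-inverses of hermitian matrices *)

Section HermitianPseudoInverse.
Local Open Scope sesquilinear_scope.
Variable C : numClosedFieldType.

(** The diagonal of [B *m B^t*] consists of the squared norms of the rows of [B]. *)
Lemma mulmx_trmxC_eq0 m n (B : 'M[C]_(m, n)) : B *m B^t* = 0 -> B = 0.
Proof.
move=> BB0; apply/matrixP => i j; rewrite !mxE.
move/matrixP: BB0 => /(_ i i); rewrite !mxE => /eqP.
rewrite psumr_eq0 => [/allP/(_ j)|l _]; last by rewrite !mxE mul_conjC_ge0.
by rewrite mem_index_enum !mxE mul_conjC_eq0 => /(_ isT)/eqP.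
Qed.

(* As A is hermitian, A^m r(A) = 0 with r(0) != 0 implies A r(A) = 0, that is
   A = A^2 t(A); then t(A)^2 A is the pseudo-inverse. *)
Lemma hermitian_pinv n (A : 'M[C]_n.+1) : A^t* = A ->
  exists q : {poly C}, let F := horner_mx A q in
    A * F * A = A /\ F * A * F = F.
Proof.
move=> Aherm.
have hX := horner_mx_X A.
have AXherm m : (A ^+ m)^t* = A ^+ m.
  elim: m => [|m IHm]; first by rewrite expr0 trmx1 map_mx1.
  by rewrite exprSr trmx_mul map_mxM Aherm IHm mulmxE -exprS -exprSr.
(* As [A] is hermitian, [B * A ^+ m.+1] times its adjoint has the factor [B * A ^+ m.+2], hence
   vanishes. *)
have cut (B : 'M[C]_n.+1) m : B * A ^+ m.+2 = 0 -> B * A ^+ m.+1 = 0.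
  move=> BA0; apply: mulmx_trmxC_eq0; rewrite trmx_mul map_mxM AXherm.
  rewrite !mulmxE mulrA -(mulrA B) -exprD addSnnS addnC exprD mulrA.
  by rewrite BA0 !mul0r.
(* [r] is the characteristic polynomial stripped of its root 0; Cayley-Hamilton then gives r(A) A^m
   = 0. *)
have [m [r r0 charE]] := multiplicity_XsubC (char_poly A) 0.
have {}r0 : r.[0] != 0.
  by move: r0; rewrite monic_neq0 ?char_poly_monic //=.
have hrA : horner_mx A r * A = 0.
  have : horner_mx A r * A ^+ m.+1 = 0.
    have := Cayley_Hamilton A; rewrite charE subr0 rmorphM rmorphXn /= hX => hA.
    by rewrite exprSr mulrA hA mul0r.
  by elim: m {charE} => [|m IHm]; [rewrite expr1 | move/cut/IHm].
have /factor_theorem[s rE] : root (r - r.[0]%:P) 0.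
  by rewrite rootE !hornerE subrr.
(* Chosen so that [t * 'X] is 1 - r / r(0), which acts as 1 once multiplied by [A]. *)
pose t := - (r.[0])^-1 *: s.
have At : horner_mx A (t * 'X * 'X) = A.
  have : horner_mx A ((r - r.[0]%:P) * 'X) = - r.[0] *: A.
    rewrite mulrBl raddfB /= rmorphM /= hX hrA sub0r mul_polyC linearZ /= hX.
    by rewrite scaleNr.
  rewrite rE subr0 /t -!scalerAl linearZ /= => ->.
  by rewrite scalerA mulrNN mulVf // scale1r.
have htX (u : {poly C}) : horner_mx A (u * (t * 'X * 'X)) = horner_mx A (u * 'X).
  by rewrite [LHS]rmorphM /= At rmorphM /= hX.
exists (t * t * 'X) => /=; split.
  rewrite -{1 3}hX -!rmorphM /=.
  have -> : 'X * (t * t * 'X) * 'X = (t * 'X) * (t * 'X * 'X) by ring.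
  by rewrite htX At.
rewrite -{2}hX -!rmorphM /=.
have -> : t * t * 'X * 'X * (t * t * 'X) = (t * t * t * 'X) * (t * 'X * 'X) by ring.
rewrite htX.
have -> : t * t * t * 'X * 'X = (t * t) * (t * 'X * 'X) by ring.
by rewrite htX.
Qed.
End HermitianPseudoInverse.

(** * Existence of a convolution pseudo-inverse *)

Section WeingartenExists.
Local Open Scope sesquilinear_scope.
Variables (R : realType) (k : nat).
Local Notation C := R[i].
Let N := #|{: 'S_k}|.-1.

Let cardS : #|{: 'S_k}| = N.+1.
Proof. by rewrite /N prednK //; apply/card_gt0P; exists 1%g. Qed.

Let e (s : 'S_k) : 'I_N.+1 := cast_ord cardS (enum_rank s).
Let d (a : 'I_N.+1) : 'S_k := enum_val (cast_ord (esym cardS) a).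

Let eK : cancel e d. Proof. by move=> s; rewrite /d /e cast_ordK enum_rankK. Qed.
Let dK : cancel d e. Proof. by move=> s; rewrite /d /e enum_valK cast_ordKV. Qed.

(** The regular representation, which turns convolution into the matrix product. The size has the
    successor form [N.+1] so that these matrices form a ring and [horner_mx] applies. *)
Definition conv_mx (f : {ffun 'S_k -> C}) : 'M[C]_N.+1 :=
  \matrix_(a, b) f (d b * (d a)^-1)%g.

Lemma conv_mxE f s t : conv_mx f (e s) (e t) = f (t * s^-1)%g.
Proof. by rewrite mxE !eK. Qed.

Lemma conv_mx_inj : injective conv_mx.
Proof.
move=> f g fg; apply/ffunP => s.
by rewrite -[s]mulg1 -invg1 -!conv_mxE fg.
Qed.

Lemma conv_mxM f g : conv_mx (convolution f g) = conv_mx f *m conv_mx g.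
Proof.
apply/matrixP => a b; rewrite -[a]dK -[b]dK conv_mxE ffunE mxE.
have dbij : {on predT, bijective d} by apply: onW_bij; exists e.
rewrite (reindex_inj (mulIg (d a)^-1%g)) (reindex d) //=.
apply: eq_bigr => c _; rewrite !mxE !eK; congr (_ * g _).
by rewrite invMg invgK mulgA mulgKV.
Qed.

(** By the first condition the entry at [s], [t] depends only on [t * s^-1], so that [M] is the
    matrix of a convolution; by the second the convolving function is a class function. *)
Definition bi_invariant (M : 'M[C]_N.+1) : Prop :=
  (forall x s t, M (e (s * x)%g) (e (t * x)%g) = M (e s) (e t)) /\
  (forall x s t, M (e (x * s)%g) (e (x * t)%g) = M (e s) (e t)).

(** Bi-invariance means commuting with the permutation matrices of all translations, a property that
    polynomials in [M] inherit. *)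
Lemma bi_invariant_horner M q : bi_invariant M -> bi_invariant (horner_mx M q).
Proof.
move=> [Mr Ml].
have ebij : {on predT, bijective e} by apply: onW_bij; exists d.
have e_eq s t : (e s == e t) = (s == t) by apply: (can_eq eK).
elim/poly_ind: q => [|q c [qr ql]].
  by rewrite rmorph0; split=> *; rewrite !mxE.
rewrite rmorphD rmorphM /= horner_mx_X horner_mx_C; split=> x s t.
  rewrite !mxE !e_eq (inj_eq (mulIg x)); congr (_ + _).
  rewrite (reindex e) //= (reindex_inj (mulIg x)) [RHS](reindex e) //=.
  by apply: eq_bigr => u _; rewrite qr Mr.
rewrite !mxE !e_eq (inj_eq (mulgI x)); congr (_ + _).
rewrite (reindex e) //= (reindex_inj (mulgI x)) [RHS](reindex e) //=.
by apply: eq_bigr => u _; rewrite ql Ml.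
Qed.

(* The pseudo-inverse matrix is a polynomial in conv_mx g, hence itself the
   matrix of convolution by a central element. *)
Lemma pseudo_inverse_exists (z : C) :
  class_function (pow_kappa k z) ->
  (forall s : 'S_k, (pow_kappa k z s)^* = pow_kappa k z s^-1%g) ->
  exists f, is_WgU (k := k) z f.
Proof.
move=> gclass gherm; set g := pow_kappa k z in gclass gherm.
have /hermitian_pinv[q] : (conv_mx g)^t* = conv_mx g.
  by apply/matrixP => a b; rewrite !mxE gherm invMg invgK.
set F := horner_mx _ q => /= -[GFG FGF].
have [Fr Fl] : bi_invariant F.
  apply: bi_invariant_horner; split=> x s t; rewrite !conv_mxE.
    by rewrite invMg mulgA mulgK.
  by rewrite invMg -(gclass _ x) conjgE !mulgA mulVg mul1g mulgKV.
(* A right-invariant matrix is determined by its row at the identity. *)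
pose f := [ffun s => F (e 1%g) (e s)].
have fE : conv_mx f = F.
  apply/matrixP => a b; rewrite mxE ffunE -[in RHS](dK a) -[in RHS](dK b).
  by rewrite -(Fr (d a) 1%g) mul1g mulgKV.
exists f; split.
- move=> s t; rewrite !ffunE conjgE.
  by rewrite -[in RHS](Fr t) -[in RHS](Fl t^-1%g) mul1g mulVg.
- by apply: conv_mx_inj; rewrite !conv_mxM fE !mulmxE.
- by apply: conv_mx_inj; rewrite !conv_mxM fE !mulmxE.
Qed.
End WeingartenExists.

(** * The central function n^kappa *)

Section PowKappa.
Variables (R : realType) (k n : nat).
Hypothesis hn : (0 < n)%N.

(** Both sides are [Tr_perm s] of the identity matrix: each cycle contributes a trace [n], and the
    product of deltas retains the labellings that are constant along [s]. *)
Lemma pow_kappaE (s : 'S_k) :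
  pow_kappa k (n%:R : R[i]) s =
  \sum_(c : {ffun 'I_k -> 'I_n}) (c == [ffun r => c (s r)])%:R.
Proof.
have <- : Tr_perm s (1%:M : 'M[R[i]]_n) = pow_kappa k (n%:R : R[i]) s.
  rewrite Tr_permE // -(trace_perm_prod s (Ordinal hn)) ffunE /kappa.
  rewrite -prodr_const; apply: eq_bigr => B _.
  by rewrite expr1n mxtrace1.
rewrite Tr_permE //; apply: eq_bigr => c _.
rewrite (eq_bigr (fun r => (c r == c (s r))%:R)) => [|r _]; last by rewrite mxE.
case: eqP => [cE|/eqP cN].
  by rewrite big1 // => r _; rewrite {1}cE ffunE eqxx.
have /existsP[r rP] : [exists r, c r != c (s r)].
  apply: contraNT cN => /existsPn cs; apply/eqP/ffunP => r.
  by rewrite ffunE; apply/eqP; rewrite -[_ == _]negbK cs.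
by rewrite (bigD1 r) //= (negPf rP) mul0r.
Qed.

(** Relabelling by [t] matches the labellings fixed by a conjugate with those fixed by [s]. *)
Lemma pow_kappa_class : class_function (pow_kappa k (n%:R : R[i])).
Proof.
move=> s t; rewrite !pow_kappaE.
rewrite (reindex_onto (fun c : {ffun 'I_k -> 'I_n} => [ffun r => c (t^-1%g r)])
  (fun c : {ffun 'I_k -> 'I_n} => [ffun r => c (t r)])) /=; last first.
  by move=> c _; apply/ffunP => r; rewrite !ffunE permKV.
apply: eq_big => [c|c _].
  by apply/eqP/ffunP => r; rewrite !ffunE permK.
congr (_%:R); congr (nat_of_bool _); apply/eqP/eqP => cE; apply/ffunP => r.
  have := congr1 (fun h : {ffun _ -> _} => h (t r)) cE.
  by rewrite !ffunE conjgE !permM !permK.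
have := congr1 (fun h : {ffun _ -> _} => h (t^-1%g r)) cE.
by rewrite !ffunE conjgE !permM !permK.
Qed.

Lemma pow_kappaV (s : 'S_k) :
  pow_kappa k (n%:R : R[i]) s^-1%g = pow_kappa k (n%:R : R[i]) s.
Proof. by rewrite !ffunE /kappa porbitsV. Qed.

(** Existence makes [xget] return a true pseudo-inverse. The matrix of n^kappa is hermitian since
    its values are real and an inverse has the same cycles. *)
Lemma WgU_natP : is_WgU (n%:R : R[i]) (WgU k (n%:R : R[i])).
Proof.
have [f fP] : exists f, is_WgU (k := k) (n%:R : R[i]) f.
  apply: pseudo_inverse_exists; first exact: pow_kappa_class.
  by move=> s; rewrite pow_kappaV ffunE rmorphXn /= conjC_nat.
by rewrite /WgU; apply: (xgetI 0 (fP : [set f | is_WgU (n%:R : R[i]) f]%classic f)).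
Qed.
End PowKappa.

(** * Operators on tensor powers and polarization *)

Section TensorPowers.
Local Open Scope sesquilinear_scope.
Variables (C : numClosedFieldType) (k n : nat).
Local Notation I := {ffun 'I_k -> 'I_n}.
Implicit Types (F G T K : I -> I -> C) (X Y : 'M[C]_n).

(** An operator on the k-th tensor power of C^n, in the basis of multi-indices. *)
Definition kernel_mx F : 'M[C]_#|{: I}| :=
  \matrix_(a, b) F (enum_val a) (enum_val b).

Lemma kernel_mxM F G :
  kernel_mx F *m kernel_mx G = kernel_mx (fun a b => \sum_c F a c * G c b).
Proof.
apply/matrixP => a b; rewrite !mxE (reindex (@enum_val I predT)) /=.
  by apply: eq_bigr => c _; rewrite !mxE.
by apply: onW_bij; exact: enum_val_bij.
Qed.

Lemma comm_kernelP F G :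
  comm_mx (kernel_mx F) (kernel_mx G) <->
  (forall a b, \sum_c F a c * G c b = \sum_c G a c * F c b).
Proof.
rewrite /comm_mx !kernel_mxM; split=> [FG a b|FG].
  move/matrixP: FG => /(_ (enum_rank a) (enum_rank b)).
  by rewrite !mxE !enum_rankK.
by apply/matrixP => a b; rewrite !mxE.
Qed.

Lemma kernel_mx_sum (J : finType) (c : J -> C) (F : J -> I -> I -> C) :
  kernel_mx (fun a b => \sum_j c j * F j a b) = \sum_j c j *: kernel_mx (F j).
Proof.
apply/matrixP => a b; rewrite mxE summxE.
by apply: eq_bigr => j _; rewrite !mxE.
Qed.

Lemma comm_kernel_sum (J : finType) (c : J -> C) (F : J -> I -> I -> C) G T :
  (forall a b, G a b = \sum_j c j * F j a b) ->
  (forall j, comm_mx (kernel_mx T) (kernel_mx (F j))) ->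
  comm_mx (kernel_mx T) (kernel_mx G).
Proof.
move=> GE FT; have -> : kernel_mx G = \sum_j c j *: kernel_mx (F j).
  by rewrite -kernel_mx_sum; apply/matrixP => a b; rewrite !mxE.
apply: comm_mx_sum => j _; rewrite /comm_mx -scalemxAr -scalemxAl.
by rewrite [_ *m _]FT.
Qed.

Definition tensor_power X (a b : I) : C := \prod_r X (a r) (b r).

Lemma tensor_powerME X Y a b :
  tensor_power (X *m Y) a b = \sum_c tensor_power X a c * tensor_power Y c b.
Proof.
rewrite /tensor_power; under eq_bigr do rewrite mxE.
rewrite bigA_distr_bigA; apply: eq_bigr => c _; exact: big_split.
Qed.

Lemma tensor_powerM X Y :
  kernel_mx (tensor_power (X *m Y)) =
  kernel_mx (tensor_power X) *m kernel_mx (tensor_power Y).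
Proof. by rewrite kernel_mxM; apply/matrixP => a b; rewrite !mxE tensor_powerME. Qed.

(** A diagonal matrix sees only the content of the multi-index [a]. *)
Lemma prod_fibers (V : comNzRingType) (d : 'I_n -> V) (a : I) :
  \prod_r d (a r) = \prod_l d l ^+ #|[pred r | a r == l]|.
Proof.
rewrite (partition_big a predT) //=; apply: eq_bigr => l _.
rewrite -prodr_const; apply: eq_big => // r /eqP arl; by rewrite arl.
Qed.

(** The nonzero polynomial X^p - X^q has finitely many roots, while the Cayley transforms (1 + ti) /
    (1 - ti) of natural numbers [t] are infinitely many points of the unit circle. *)
Lemma unit_circle_exp_neq p q : p != q ->
  exists u : C, u * u^* = 1 /\ u ^+ p != u ^+ q.
Proof.
move=> pq; pose P : {poly C} := 'X^p - 'X^q.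
have P0 : P != 0.
  apply/eqP => /(congr1 (fun Q : {poly C} => Q`_p)) /eqP.
  by rewrite coefB !coefXn coef0 eqxx (negPf pq) subr0 oner_eq0.
pose v (t : nat) : C := 1 + t%:R * 'i.
have vC t : (v t)^* = 1 - t%:R * 'i.
  by rewrite /v rmorphD rmorphM /= rmorph1 conjC_nat conjCi mulrN.
have vv t : v t * (v t)^* != 0.
  rewrite vC /v mulrC -subr_sqr expr1n exprMn sqrCi mulrN1 opprK.
  by rewrite -natrX nat1r pnatr_eq0.
have v0 t : v t != 0 by have := vv t; rewrite mulf_eq0 => /norP[].
have vC0 t : (v t)^* != 0 by have := vv t; rewrite mulf_eq0 => /norP[].
pose u t := v t / (v t)^*.
have u1 t : u t * (u t)^* = 1.
  by rewrite /u rmorphM fmorphV /= conjCK mulrA divfK // mulfV.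
have u_inj : injective u.
  move=> s t /eqP; rewrite /u eqr_div // !vC /v.
  have -> : (1 + s%:R * 'i) * (1 - t%:R * 'i) =
    1 + (s%:R - t%:R) * 'i - s%:R * t%:R * ('i * 'i) :> C by ring.
  have -> : (1 + t%:R * 'i) * (1 - s%:R * 'i) =
    1 - (s%:R - t%:R) * 'i - s%:R * t%:R * ('i * 'i) :> C by ring.
  rewrite (inj_eq (addIr _)) (inj_eq (addrI _)) eq_sym eqNr.
  by rewrite mulf_eq0 (negPf (neq0Ci _)) orbF subr_eq0 eqr_nat => /eqP.
(* A nonzero [P] has fewer than [size P] roots, so [size P] distinct points suffice. *)
have us_uniq : uniq (map u (iota 0 (size P))) by rewrite map_inj_uniq ?iota_uniq.
have := contraNN (fun x => max_poly_roots P0 x us_uniq).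
rewrite size_map size_iota ltnn => /(_ isT) /allPn[_ /mapP[t _ ->] Put].
exists (u t); split=> //.
by move: Put; rewrite rootE !hornerE subr_eq0.
Qed.

(** The symmetrization, without the factor 1/k!, of the tensor product of the matrices [Y s]. *)
Definition sym_tensor (Y : 'I_k -> 'M[C]_n) (a b : I) : C :=
  \sum_(rho : 'S_k) \prod_s Y s (a (rho s)) (b (rho s)).

(** Inclusion-exclusion over the sets containing the image of [f] detects surjectivity, which for a
    self-map of a finite set is injectivity. *)
Lemma sum_signed_supersets (f : {ffun 'I_k -> 'I_k}) :
  \sum_(S : {set 'I_k}) (-1) ^+ #|~: S| * [forall r, f r \in S]%:R =
  (injectiveb f)%:R :> C.
Proof.
(* The sum is the expansion of the product of the [1 + F s], where a factor is 1 at a value of [f]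
   and 0 elsewhere. *)
pose F (s : 'I_k) : C := - (s \notin codom f)%:R.
transitivity (\sum_(S : {set 'I_k}) \prod_s (if s \in S then 1 else F s)).
  apply: eq_bigr => S _.
  rewrite (bigID (mem S)) /= big1 ?mul1r => [|s ->] //.
  have -> : \prod_(s | s \notin S) (if s \in S then 1 else F s) =
            \prod_(s | s \notin S) F s.
    by apply: eq_bigr => s /negPf ->.
  case: forallP => [fS|fS].
    rewrite mulr1 -prodr_const; apply: eq_big => [s|s]; rewrite inE // => sS.
    rewrite /F; suff -> : s \notin codom f by [].
    by apply: contra sS => /codomP[r ->].
  have /existsP[r rS] : [exists r, f r \notin S].
    by rewrite -negb_forall; apply/forallP.
  by rewrite mulr0 (bigD1 (f r)) //= /F codom_f oppr0 mul0r.
rewrite -bigA_distr; case: injectiveP => [finj|fN].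
  rewrite big1 // => s _; rewrite /F.
  by rewrite injF_onto //= mulr0n subr0.
suff /existsP[s sP] : [exists s, s \notin codom f].
  by rewrite (bigD1 s) //= /F sP subrr mul0r.
rewrite -negb_forall; apply/negP => /forallP fsurj; apply: fN.
apply/injectiveP; rewrite /injectiveb /dinjectiveb -/(codom f).
apply/card_uniqP; rewrite size_codom.
by apply: eq_card => s; rewrite fsurj.
Qed.

Lemma sum_injective (G : {ffun 'I_k -> 'I_k} -> C) :
  \sum_(f : {ffun 'I_k -> 'I_k}) (injectiveb f)%:R * G f =
  \sum_(rho : 'S_k) G (pval rho).
Proof.
rewrite (bigID (fun f : {ffun 'I_k -> 'I_k} => injectiveb f)) /= addrC.
rewrite big1 ?add0r => [|f /negPf ->]; last by rewrite mul0r.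
rewrite (reindex (@pval _)) /=; last first.
  pose in_S := insubd (1%g : 'S_k).
  by exists in_S => /= f Uf; first apply: val_inj; apply: insubdK.
by apply: eq_big => [s|s _]; rewrite (valP s) ?mul1r.
Qed.

(** Expanding the tensor powers yields one term per map from slots to matrices, and the signs keep
    the bijections. If all [Y s] are hermitian, so are the partial sums, which are then normal. *)
Lemma polarization (Y : 'I_k -> 'M[C]_n) a b :
  sym_tensor Y a b =
  \sum_(S : {set 'I_k}) (-1) ^+ #|~: S| * tensor_power (\sum_(s in S) Y s) a b.
Proof.
pose G (f : {ffun 'I_k -> 'I_k}) := \prod_r Y (f r) (a r) (b r).
transitivity (\sum_(f : {ffun 'I_k -> 'I_k}) (injectiveb f)%:R * G f).
  rewrite sum_injective [RHS](reindex_inj invg_inj).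
  apply: eq_bigr => rho _; rewrite /G [RHS](reindex_perm rho).
  by apply: eq_bigr => s _; rewrite pvalE permK.
under eq_bigr do rewrite -sum_signed_supersets mulr_suml.
rewrite exchange_big; apply: eq_bigr => S _ /=.
under eq_bigr do rewrite -mulrA; rewrite -mulr_sumr; congr (_ * _).
rewrite /tensor_power.
under [RHS]eq_bigr do rewrite summxE big_mkcond.
rewrite bigA_distr_bigA; apply: eq_bigr => f _.
case: forallP => [fS|fS].
  by rewrite mul1r; apply: eq_bigr => r _; rewrite fS.
have /existsP[r /negPf rS] : [exists r, f r \notin S].
  by rewrite -negb_forall; apply/forallP.
by rewrite mul0r (bigD1 r) //= rS mul0r.
Qed.

(** * The commutant of the unitary tensor powers *)

Section UnitaryCommutant.
Variable T : I -> I -> C.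
Hypothesis TU : forall U, U \is unitarymx ->
  comm_mx (kernel_mx T) (kernel_mx (tensor_power U)).

Lemma tensor_power_diag (d : 'I_n -> C) a b :
  tensor_power (diag_mx (\row_l d l)) a b = (a == b)%:R * \prod_r d (a r).
Proof.
rewrite /tensor_power; case: eqP => [<-|/eqP ab].
  by rewrite mul1r; apply: eq_bigr => r _; rewrite !mxE eqxx.
have /existsP[r rP] : [exists r, a r != b r].
  apply: contraNT ab => /existsPn abr; apply/eqP/ffunP => r.
  by apply/eqP; rewrite -[_ == _]negbK abr.
by rewrite (bigD1 r) //= !mxE (negPf rP) mulr0n !mul0r.
Qed.

Lemma comm_tensor_diagP (d : 'I_n -> C) :
  comm_mx (kernel_mx T) (kernel_mx (tensor_power (diag_mx (\row_l d l)))) <->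
  (forall a b, T a b * \prod_r d (b r) = T a b * \prod_r d (a r)).
Proof.
rewrite comm_kernelP.
have L a b : \sum_c T a c * tensor_power (diag_mx (\row_l d l)) c b =
             T a b * \prod_r d (b r).
  rewrite (bigD1 b) //= tensor_power_diag eqxx mul1r [X in _ + X]big1 ?addr0 // => c cb.
  by rewrite tensor_power_diag (negPf cb) mul0r mulr0.
have Rr a b : \sum_c tensor_power (diag_mx (\row_l d l)) a c * T c b =
             T a b * \prod_r d (a r).
  rewrite (bigD1 a) //= tensor_power_diag eqxx mul1r [X in _ + X]big1 ?addr0 1?mulrC // => c ca.
  by rewrite tensor_power_diag eq_sym (negPf ca) !mul0r.
by split=> H a b; move: (H a b); rewrite L Rr.
Qed.

(* The diagonal unitary with a single entry u != 1 acts on e_a with weight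
   u^#{r | a_r = l}. *)
Lemma commutant_weight a b l : T a b != 0 ->
  #|[pred r | a r == l]| = #|[pred r | b r == l]|.
Proof.
move=> Tab; apply/eqP; apply: contraT => /unit_circle_exp_neq[u [u1]].
pose d l' := if l' == l then u else 1.
have dprod (c : I) : \prod_r d (c r) = u ^+ #|[pred r | c r == l]|.
  rewrite (prod_fibers d) (bigD1 l) //= /d eqxx big1 ?mulr1 // => l' l'l.
  by rewrite (negPf l'l) expr1n.
have /TU/comm_tensor_diagP/(_ a b) : diag_mx (\row_l d l) \is unitarymx.
  apply/unitarymxP/matrixP => x y; rewrite tr_diag_mx map_diag_mx mulmx_diag !mxE.
  by rewrite /d; case: ifP; rewrite ?u1 // rmorph1 mulr1.
by rewrite !dprod => /(mulfI Tab) ->; rewrite eqxx.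
Qed.

Lemma comm_tensor_diag (d : 'rV[C]_n) :
  comm_mx (kernel_mx T) (kernel_mx (tensor_power (diag_mx d))).
Proof.
have -> : d = \row_l d 0 l by apply/rowP => l; rewrite mxE.
apply/comm_tensor_diagP => a b; have [->|Tab] := eqVneq (T a b) 0.
  by rewrite !mul0r.
congr (_ * _); rewrite !(prod_fibers (d 0)).
by apply: eq_bigr => l _; rewrite (commutant_weight l Tab).
Qed.

Lemma comm_tensor_normal X : X \is normalmx ->
  comm_mx (kernel_mx T) (kernel_mx (tensor_power X)).
Proof.
move=> /orthomx_spectralP ->; have UP := spectral_unitarymx X.
rewrite !tensor_powerM; apply: comm_mxM; first apply: comm_mxM.
- by apply: TU; rewrite invmx_unitary // trmxC_unitary.
- exact: comm_tensor_diag.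
- exact: TU.
Qed.

Lemma comm_sym_hermitian (Y : 'I_k -> 'M[C]_n) :
  (forall s, (Y s)^t* = Y s) ->
  comm_mx (kernel_mx T) (kernel_mx (sym_tensor Y)).
Proof.
move=> Yherm; apply: (comm_kernel_sum (polarization Y)) => S.
apply: comm_tensor_normal; apply/normalmxP.
have -> // : (\sum_(s in S) Y s)^t* = \sum_(s in S) Y s.
rewrite !raddf_sum /=; exact: eq_bigr.
Qed.

(** [sym_tensor] is multilinear, and every matrix is H + iH' with H and H' hermitian. *)
Lemma comm_sym_tensor (Y : 'I_k -> 'M[C]_n) :
  comm_mx (kernel_mx T) (kernel_mx (sym_tensor Y)).
Proof.
pose H (e : bool) s : 'M[C]_n :=
  if e then 2^-1 *: (Y s + (Y s)^t*) else - 'i *: (2^-1 *: (Y s - (Y s)^t*)).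
pose c (e : bool) : C := if e then 1 else 'i.
have Hherm e s : (H e s)^t* = H e s.
  apply/matrixP => x y; rewrite /H; case: e; rewrite !mxE.
    by rewrite rmorphM rmorphD /= fmorphV /= conjC_nat conjCK addrC.
  rewrite !rmorphM rmorphB rmorphN /= fmorphV /= conjC_nat conjCK conjCi.
  by rewrite -[in RHS]opprB !mulrN !mulNr.
have YE s x y : Y s x y = \sum_e c e * H e s x y.
  rewrite big_bool /c /H /= !mxE mul1r mulNr mulrN (mulrA 'i 'i) -expr2 sqrCi.
  rewrite mulN1r opprK -mulrDr /=.
  by rewrite addrACA subrr addr0 -mulr2n -(mulr_natl (Y s x y)) mulKf // pnatr_eq0.
apply: (@comm_kernel_sum {ffun 'I_k -> bool} (fun e => \prod_s c (e s))
  (fun e => sym_tensor (fun s => H (e s) s))) => [a b|e]; last first.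
  by apply: comm_sym_hermitian => s; exact: Hherm.
rewrite /sym_tensor; under [RHS]eq_bigr do rewrite mulr_sumr.
rewrite exchange_big; apply: eq_bigr => rho _ /=.
under eq_bigr do rewrite YE.
rewrite bigA_distr_bigA; apply: eq_bigr => e _; exact: big_split.
Qed.

(** Being equal to the average of its conjugates under [S_k], [K] is the combination of the
    symmetrized matrix units [sym_tensor (Y p)] with weights [K p.1 p.2] over k!. *)
Lemma comm_invariant K :
  (forall (rho : 'S_k) (a b : I),
    K [ffun r => a (rho r)] [ffun r => b (rho r)] = K a b) ->
  comm_mx (kernel_mx T) (kernel_mx K).
Proof.
move=> Kinv; pose Y (p : I * I) s : 'M[C]_n := delta_mx (p.1 s) (p.2 s).
have k0 : k`!%:R != 0 :> C by rewrite pnatr_eq0 -lt0n fact_gt0.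
apply: (@comm_kernel_sum (I * I)%type (fun p => k`!%:R^-1 * K p.1 p.2)
  (fun p => sym_tensor (Y p))) => [a b|p]; last exact: comm_sym_tensor.
have YE p (rho : 'S_k) : \prod_s Y p s (a (rho s)) (b (rho s)) =
    (p == ([ffun r => a (rho r)], [ffun r => b (rho r)]))%:R.
  case: eqP => [->|/eqP pN].
    by rewrite big1 // => s _; rewrite mxE !ffunE !eqxx.
  have /existsP[r rP] : [exists r, (a (rho r), b (rho r)) != (p.1 r, p.2 r)].
    apply: contraNT pN => /existsPn pr.
    rewrite [p]surjective_pairing; apply/eqP; congr (_, _); apply/ffunP => r;
      rewrite ffunE; have /negPn/eqP[] := pr r => //.
  by rewrite (bigD1 r) //= mxE -xpair_eqE (negPf rP) mul0r.
rewrite /sym_tensor; under eq_bigr do rewrite mulr_sumr.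
rewrite exchange_big /=.
transitivity (\sum_(rho : 'S_k) k`!%:R^-1 * K a b).
  by rewrite sumr_const card_Sn -(mulr_natl (_ * K a b)) mulrA mulfV // mul1r.
apply: eq_bigr => rho _; under eq_bigr do rewrite YE.
rewrite (bigD1 ([ffun r => a (rho r)], [ffun r => b (rho r)])) //= eqxx mulr1.
rewrite Kinv big1 ?addr0 // => p /negPf ->; by rewrite mulr0.
Qed.

End UnitaryCommutant.
End TensorPowers.

(** * Permutation operators and the Weingarten expansion *)

Section WeingartenExpansion.
Variables (R : realType) (k n : nat).
Hypothesis hn : (0 < n)%N.
Local Notation C := R[i].
Local Notation I := {ffun 'I_k -> 'I_n}.

Definition perm_kernel (s : 'S_k) (a b : I) : C := (b == [ffun r => a (s r)])%:R.

Lemma delta_permE (s : 'S_k) (a b : I) : delta_perm R s a b = perm_kernel s a b.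
Proof.
rewrite /delta_perm /perm_kernel; case: eqP => [->|/eqP abN].
  by rewrite big1 // => r _; rewrite ffunE eqxx.
have /existsP[r /negPf rP] : [exists r, a (s r) != b r].
  apply: contraNT abN => /existsPn abr; apply/eqP/ffunP => r; rewrite ffunE.
  by apply/esym/eqP; rewrite -[_ == _]negbK abr.
by rewrite (bigD1 r) //= rP mul0r.
Qed.

Lemma sum_perm_kernel (s : 'S_k) (a : I) (F : I -> C) :
  \sum_b perm_kernel s a b * F b = F [ffun r => a (s r)].
Proof.
rewrite (bigD1 [ffun r => a (s r)]) //= /perm_kernel eqxx mul1r big1 ?addr0 //.
by move=> b /negPf ->; rewrite mul0r.
Qed.

Lemma perm_kernel_comp (s t : 'S_k) (a b : I) :
  perm_kernel s [ffun r => a (t r)] b = perm_kernel (s * t)%g a b.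
Proof.
congr ((b == _)%:R); apply/ffunP => r; by rewrite !ffunE permM.
Qed.

Local Notation g := (pow_kappa k (n%:R : C)).
Local Notation f := (WgU k (n%:R : C)).

(** The Gram matrix of the permutation operators is given by n^kappa; this is how its pseudo-inverse
    enters. *)
Lemma perm_kernel_gram (s t : 'S_k) :
  \sum_a \sum_b perm_kernel s a b * perm_kernel t a b = g (s^-1 * t)%g.
Proof.
rewrite pow_kappaE //; apply: eq_bigr => a _; rewrite sum_perm_kernel.
congr (_%:R); congr (nat_of_bool _); apply/eqP/eqP => aE; apply/ffunP => r.
  have := congr1 (fun h : I => h (s^-1%g r)) aE.
  by rewrite !ffunE permM permKV.
have := congr1 (fun h : I => h (s r)) aE.
by rewrite !ffunE permM permK.
Qed.

(** The equation g * f * g = g with both sums reindexed by inversion, [g] being invariant under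
    inversion and [f] a class function. *)
Lemma WgU_pinv (p : 'S_k) :
  \sum_s (\sum_t f (t * s^-1)%g * g t) * g (p * s)%g = g p.
Proof.
have [fclass /ffunP/(_ p) gfg _] := WgU_natP R k hn.
rewrite -[RHS]gfg ffunE [RHS](reindex_inj invg_inj) /=.
apply: eq_bigr => s _; rewrite invgK; congr (_ * _).
rewrite ffunE [RHS](reindex_inj invg_inj) /=.
apply: eq_bigr => t _; rewrite invgK pow_kappaV mulrC -(fclass (t * s^-1)%g t).
by congr (_ * f _); rewrite conjgE mulgA mulKg.
Qed.

(* The difference F of the two sides lies in the span of the permutation kernels
   and is orthogonal to all of them, so its squared norm vanishes. *)
Lemma perm_kernel_unit (a b : I) :
  \sum_s perm_kernel s a b * (\sum_t f (t * s^-1)%g * g t) = (a == b)%:R.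
Proof.
(* The identity operator is the permutation kernel of [1%g], whence the subtracted delta. *)
pose c s := \sum_t f (t * s^-1)%g * g t - (s == 1%g)%:R.
pose F a b := \sum_s perm_kernel s a b * c s.
have FE a' b' : F a' b' = \sum_s perm_kernel s a' b' *
    (\sum_t f (t * s^-1)%g * g t) - (a' == b')%:R.
  rewrite /F; under eq_bigr do rewrite mulrBr.
  rewrite sumrB; congr (_ - _).
  rewrite (bigD1 1%g) //= eqxx mulr1 big1 ?addr0 => [|s /negPf ->]; last first.
    by rewrite mulr0.
  rewrite /perm_kernel eq_sym; congr ((_ == _)%:R).
  by apply/ffunP => r; rewrite ffunE perm1.
have orth p : \sum_a' \sum_b' perm_kernel p a' b' * F a' b' = 0.
  transitivity (\sum_s c s * g (p^-1 * s)%g).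
    under eq_bigr do under eq_bigr do rewrite mulr_sumr.
    under eq_bigr do rewrite exchange_big.
    rewrite exchange_big; apply: eq_bigr => s _ /=.
    rewrite -perm_kernel_gram mulr_sumr; apply: eq_bigr => a' _.
    by rewrite mulr_sumr; apply: eq_bigr => b' _; rewrite mulrA mulrC.
  rewrite /c; under eq_bigr do rewrite mulrBl.
  rewrite sumrB WgU_pinv (bigD1 1%g) //= eqxx mul1r mulg1.
  rewrite big1 ?addr0 ?subrr // => s /negPf ->; by rewrite mul0r.
have norm0 : \sum_(q : I * I) F q.1 q.2 * (F q.1 q.2)^* = 0.
  rewrite -(pair_bigA _ (fun a' b' => F a' b' * (F a' b')^*)) /=.
  (* Expanding only the conjugated factor leaves inner products with permutation kernels, whose
     entries are real. *)
  transitivity (\sum_p (c p)^* * \sum_a' \sum_b' perm_kernel p a' b' * F a' b').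
    under [RHS]eq_bigr do rewrite mulr_sumr.
    rewrite [RHS]exchange_big; apply: eq_bigr => a' _ /=.
    under [RHS]eq_bigr do rewrite mulr_sumr.
    rewrite [RHS]exchange_big; apply: eq_bigr => b' _ /=.
    rewrite {2}/F rmorph_sum mulr_sumr; apply: eq_bigr => p _.
    by rewrite rmorphM /= conjC_nat mulrC -mulrA mulrCA.
  by rewrite big1 // => p _; rewrite orth mulr0.
apply/eqP; rewrite -subr_eq0 -FE -mul_conjC_eq0.
move/eqP: norm0; rewrite psumr_eq0 => [/allP/(_ (a, b))|q _].
  by rewrite mem_index_enum => /(_ isT).
exact: mul_conjC_ge0.
Qed.

Lemma unitary_commutant_expansion (T : I -> I -> C) :
  (forall U, U \is unitarymx ->
     comm_mx (kernel_mx T) (kernel_mx (tensor_power (k := k) U))) ->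
  forall a b, T a b =
    \sum_(sigma : 'S_k) \sum_(tau : 'S_k)
      perm_kernel sigma a b * f (tau * sigma^-1)%g *
      \sum_c T c [ffun r => c (tau r)].
Proof.
move=> TU a b.
pose K b d a c : C := \sum_(s : 'S_k) \sum_(t : 'S_k)
  perm_kernel s a b * f (t * s^-1)%g * perm_kernel t c d.
(* Multiplying [s] and [t] on the right by [rho] leaves [t * s^-1] unchanged. *)
have Kinv b' d (rho : 'S_k) (a' c : I) :
    K b' d [ffun r => a' (rho r)] [ffun r => c (rho r)] = K b' d a' c.
  rewrite /K [RHS](reindex_inj (mulIg rho)); apply: eq_bigr => s _ /=.
  rewrite [RHS](reindex_inj (mulIg rho)); apply: eq_bigr => t _ /=.
  by rewrite !perm_kernel_comp invMg mulgA mulgK.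
(* This is p(1) = 1: summing [perm_kernel t d d] over [d] gives [g t]. *)
have Kunit e : \sum_d K b d e d = (e == b)%:R.
  rewrite -perm_kernel_unit exchange_big; apply: eq_bigr => s _ /=.
  rewrite exchange_big mulr_sumr; apply: eq_bigr => t _ /=.
  by rewrite -mulr_sumr pow_kappaE // mulrA.
have KT d : \sum_c K b d a c * T c d = \sum_c T a c * K b d c d.
  have /comm_kernelP-> // := comm_invariant TU (K := K b d) (Kinv b d).
(* The double sum is p(T) at [a], [b]; summing over [d] first and commuting [K b d] past [T] leaves
   T p(1). *)
transitivity (\sum_d \sum_c K b d a c * T c d); last first.
  rewrite exchange_big /=.
  transitivity (\sum_c \sum_s \sum_t perm_kernel s a b * f (t * s^-1)%g *
      T c [ffun r => c (t r)]).
    apply: eq_bigr => c _; under eq_bigr do rewrite mulr_suml.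
    rewrite exchange_big; apply: eq_bigr => s _ /=.
    under eq_bigr do rewrite mulr_suml.
    rewrite exchange_big; apply: eq_bigr => t _ /=.
    under eq_bigr do rewrite -mulrA.
    by rewrite -mulr_sumr (sum_perm_kernel t c (T c)).
  rewrite exchange_big; apply: eq_bigr => s _ /=.
  rewrite exchange_big; apply: eq_bigr => t _ /=.
  by rewrite mulr_sumr.
under [RHS]eq_bigr do rewrite KT.
rewrite exchange_big /=; under [RHS]eq_bigr do rewrite -mulr_sumr Kunit.
rewrite (bigD1 b) //= eqxx mulr1 big1 ?addr0 // => c /negPf ->.
by rewrite mulr0.
Qed.
End WeingartenExpansion.

(** * Measurability of complex and matrix-valued maps *)

Section ComplexMeasurability.
Variables (R : realType) (d : measure_display) (T : measurableType d).
Local Open Scope classical_set_scope.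
Local Notation C := R[i].

(** Working with the two parts lets closure under sums and products come from real functions. *)
Definition parts_measurable (f : T -> C) : Prop :=
  measurable_fun setT (fun t => complex.Re (f t)) /\
  measurable_fun setT (fun t => complex.Im (f t)).

Lemma parts_measurable_cst c : parts_measurable (fun=> c).
Proof. by split; exact: measurable_cst. Qed.

Lemma parts_measurableD f g : parts_measurable f -> parts_measurable g ->
  parts_measurable (fun t => f t + g t).
Proof.
move=> [fr fi] [gr gi]; split.
  rewrite (_ : (fun t => _) = (fun t => complex.Re (f t) + complex.Re (g t))).
    exact: measurable_funD.
  by apply/funext => t; case: (f t); case: (g t).
rewrite (_ : (fun t => _) = (fun t => complex.Im (f t) + complex.Im (g t))).
  exact: measurable_funD.
by apply/funext => t; case: (f t); case: (g t).
Qed.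

Lemma parts_measurableM f g : parts_measurable f -> parts_measurable g ->
  parts_measurable (fun t => f t * g t).
Proof.
move=> [fr fi] [gr gi]; split.
  rewrite (_ : (fun t => _) = (fun t => complex.Re (f t) * complex.Re (g t) -
      complex.Im (f t) * complex.Im (g t))).
    by apply: measurable_funB; exact: measurable_funM.
  by apply/funext => t; case: (f t); case: (g t).
rewrite (_ : (fun t => _) = (fun t => complex.Re (f t) * complex.Im (g t) +
    complex.Im (f t) * complex.Re (g t))).
  by apply: measurable_funD; exact: measurable_funM.
by apply/funext => t; case: (f t); case: (g t).
Qed.

Lemma parts_measurable_sum (J : Type) (s : seq J) (f : J -> T -> C) :
  (forall j, parts_measurable (f j)) ->
  parts_measurable (fun t => \sum_(j <- s) f j t).
Proof.
move=> fm; elim: s => [|j s IHs].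
  rewrite (_ : (fun t => _) = fun=> 0); first exact: parts_measurable_cst.
  by apply/funext => t; rewrite big_nil.
rewrite (_ : (fun t => _) = fun t => f j t + \sum_(j <- s) f j t).
  exact: parts_measurableD.
by apply/funext => t; rewrite big_cons.
Qed.

Lemma parts_measurable_prod (J : Type) (s : seq J) (f : J -> T -> C) :
  (forall j, parts_measurable (f j)) ->
  parts_measurable (fun t => \prod_(j <- s) f j t).
Proof.
move=> fm; elim: s => [|j s IHs].
  rewrite (_ : (fun t => _) = fun=> 1); first exact: parts_measurable_cst.
  by apply/funext => t; rewrite big_nil.
rewrite (_ : (fun t => _) = fun t => f j t * \prod_(j <- s) f j t).
  exact: parts_measurableM.
by apply/funext => t; rewrite big_cons.
Qed.

Lemma parts_measurableP (f : T -> C) :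
  parts_measurable f -> measurable_fun setT f.
Proof.
move=> [fr fi]; apply: (measurability
  (preimage_set_system setT (@complex.Re R) measurable `|`
   preimage_set_system setT (@complex.Im R) measurable)) => //.
move=> _ [A [[B mB <-]|[B mB <-]] <-]; rewrite !setTI.
  by rewrite -[X in measurable X]setTI; exact: fr.
by rewrite -[X in measurable X]setTI; exact: fi.
Qed.

Lemma mx_measurable_entries m n (f : T -> 'M[C]_(m, n)) :
  (forall i j, parts_measurable (fun t => f t i j)) -> measurable_fun setT f.
Proof.
move=> fm; apply: (measurability [set A | exists i j,
  preimage_set_system [set: 'M[C]_(m, n)] (fun M : 'M[C]_(m, n) => M i j)
    measurable A]) => //.
move=> _ [A [i [j [B mB <-]]] <-]; rewrite !setTI.
have := parts_measurableP (fm i j); rewrite -[X in measurable X]setTI.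
exact.
Qed.

End ComplexMeasurability.

(** * Measurability of matrix entries and of the modulus *)

Section EntryMeasurability.
Variable R : realType.
Local Open Scope classical_set_scope.
Local Notation C := R[i].

Lemma measurable_Re : measurable_fun setT (@complex.Re R).
Proof.
by move=> _ B mB; rewrite setTI; apply: sub_sigma_algebra; left; exists B; rewrite ?setTI.
Qed.

Lemma measurable_Im : measurable_fun setT (@complex.Im R).
Proof.
by move=> _ B mB; rewrite setTI; apply: sub_sigma_algebra; right; exists B; rewrite ?setTI.
Qed.

Lemma measurable_entry m n i j :
  measurable_fun setT (fun M : 'M[C]_(m, n) => M i j).
Proof.
move=> _ B mB; rewrite setTI; apply: sub_sigma_algebra.
by exists i, j, B; rewrite ?setTI.
Qed.

Lemma parts_measurable_entry m n i j :
  parts_measurable (fun M : 'M[C]_(m, n) => M i j).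
Proof.
split; apply: measurableT_comp.
- exact: measurable_Re.
- exact: measurable_entry.
- exact: measurable_Im.
- exact: measurable_entry.
Qed.

Lemma parts_measurable_comp d (T : measurableType d) d' (T' : measurableType d')
    (f : T' -> C) (g : T -> T') :
  parts_measurable f -> measurable_fun setT g -> parts_measurable (f \o g).
Proof.
by move=> [fr fi] mg; split; [exact: measurableT_comp fr mg | exact: measurableT_comp fi mg].
Qed.

Lemma measurable_normc d (T : measurableType d) (f : T -> C) :
  parts_measurable f -> measurable_fun setT (fun t => Normc.normc (f t)).
Proof.
move=> [fr fi].
rewrite (_ : (fun t => _) = Num.sqrt \o
  (fun t => complex.Re (f t) ^+ 2 + complex.Im (f t) ^+ 2)); last first.
  by apply/funext => t /=; case: (f t).
apply: measurableT_comp.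
  apply: continuous_measurable_fun; exact: sqrt_continuous.
by apply: measurable_funD; exact: measurable_funX.
Qed.

End EntryMeasurability.

(** * Linearity of the complex expectation, and domination *)

Section ComplexExpectation.
Variables (R : realType) (d : measure_display) (T : measurableType d).
Variable P : probability T R.
Local Open Scope classical_set_scope.
Local Open Scope complex_scope.
Local Notation C := R[i].

Definition cintegrable (X : T -> C) : Prop :=
  P.-integrable setT (EFin \o (fun t => complex.Re (X t))) /\
  P.-integrable setT (EFin \o (fun t => complex.Im (X t))).

Lemma cexpectationE (X : T -> C) : cexpectation P X =
  (\int[P]_t complex.Re (X t)) +i* (\int[P]_t complex.Im (X t)).
Proof. by rewrite /cexpectation unlock. Qed.

Lemma cintegrableD X Y : cintegrable X -> cintegrable Y ->
  cintegrable (fun t => X t + Y t).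
Proof.
move=> [Xr Xi] [Yr Yi]; split.
  have := integrableD measurableT Xr Yr; apply: eq_integrable => // t _ /=.
  by case: (X t); case: (Y t).
have := integrableD measurableT Xi Yi; apply: eq_integrable => // t _ /=.
by case: (X t); case: (Y t).
Qed.

Lemma cexpectationD X Y : cintegrable X -> cintegrable Y ->
  cexpectation P (fun t => X t + Y t) = cexpectation P X + cexpectation P Y.
Proof.
move=> [Xr Xi] [Yr Yi]; rewrite !cexpectationE.
apply/eqP; rewrite eq_complex /= -!RintegralD //; apply/andP; split; apply/eqP;
  by apply: eq_Rintegral => t _; case: (X t); case: (Y t).
Qed.

Lemma cintegrableZ c X : cintegrable X -> cintegrable (fun t => c * X t).
Proof.
case: c => a b [Xr Xi]; split.
  have := integrableB measurableT (integrableZl measurableT a Xr)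
    (integrableZl measurableT b Xi).
  by apply: eq_integrable => // t _ /=; case: (X t).
have := integrableD measurableT (integrableZl measurableT a Xi)
  (integrableZl measurableT b Xr).
by apply: eq_integrable => // t _ /=; case: (X t).
Qed.

Lemma cexpectationZ c X : cintegrable X ->
  cexpectation P (fun t => c * X t) = c * cexpectation P X.
Proof.
case: c => a b [Xr Xi]; rewrite !cexpectationE.
have aXr := integrableZl measurableT a Xr.
have bXi := integrableZl measurableT b Xi.
have aXi := integrableZl measurableT a Xi.
have bXr := integrableZl measurableT b Xr.
apply/eqP; rewrite eq_complex /= -!RintegralZl // -RintegralB // -RintegralD //.
by apply/andP; split; apply/eqP; apply: eq_Rintegral => t _; case: (X t).
Qed.

Lemma cexpectation0 : cexpectation P (fun=> 0) = 0.
Proof. by rewrite cexpectationE /= /Rintegral integral0. Qed.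

Lemma cintegrable_sum (J : Type) (s : seq J) (c : J -> C) (X : J -> T -> C) :
  (forall j, cintegrable (X j)) ->
  cintegrable (fun t => \sum_(j <- s) c j * X j t) /\
  cexpectation P (fun t => \sum_(j <- s) c j * X j t) =
  \sum_(j <- s) c j * cexpectation P (X j).
Proof.
move=> Xint; elim: s => [|j s [IHi IHe]].
  rewrite (_ : (fun t => _) = fun=> 0); last by apply/funext => t; rewrite big_nil.
  by rewrite big_nil cexpectation0; split=> //; split; exact: integrable0.
rewrite (_ : (fun t => _) = fun t => c j * X j t + \sum_(j <- s) c j * X j t).
  rewrite big_cons -IHe -cexpectationZ //; split.
    by apply: cintegrableD => //; exact: cintegrableZ.
  by rewrite cexpectationD //; exact: cintegrableZ.
by apply/funext => t; rewrite big_cons.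
Qed.

Lemma cintegrable_le (X : T -> C) (Y : T -> R) : parts_measurable X ->
  P.-integrable setT (EFin \o Y) -> (forall t, Normc.normc (X t) <= Y t) ->
  cintegrable X.
Proof.
move=> [Xr Xi] Yint XY.
have ReIm (z : C) : `|complex.Re z| <= Normc.normc z /\ `|complex.Im z| <= Normc.normc z.
  case: z => a b /=; rewrite -!sqrtr_sqr.
  by split; rewrite ler_wsqrtr // ?lerDl ?lerDr ?sqr_ge0.
split; apply: (le_integrable measurableT _ _ Yint).
- exact/measurable_EFinP.
- move=> t _ /=; rewrite lee_fin (le_trans (proj1 (ReIm _))) //.
  exact: le_trans (XY t) (ler_norm _).
- exact/measurable_EFinP.
- move=> t _ /=; rewrite lee_fin (le_trans (proj2 (ReIm _))) //.
  exact: le_trans (XY t) (ler_norm _).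
Qed.

End ComplexExpectation.

(** * Moments of a unitarily invariant random matrix *)

Section InvariantMoments.
Variables (R : realType) (d : measure_display) (T : measurableType d).
Variables (P : probability T R) (n k : nat).
Variable W : {RV P >-> 'M[R[i]]_n}.
Local Open Scope classical_set_scope.
Local Open Scope sesquilinear_scope.
Local Notation C := R[i].
Local Notation I := {ffun 'I_k -> 'I_n}.

(** The product is at most the k-th power of its largest factor, which is one of the summands. *)
Lemma prod_le_sum_exp (x : 'I_k -> R) : (0 < k)%N -> (forall r, 0 <= x r) ->
  \prod_r x r <= \sum_r x r ^+ k.
Proof.
move=> k_gt0 x_ge0; pose r0 := Ordinal k_gt0.
case: (@arg_maxP _ _ _ r0 predT x isT) => m _ xm.
apply: (@le_trans _ _ (x m ^+ k)).
  rewrite -[in leRHS](card_ord k) -prodr_const.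
  by apply: ler_prod => r _; rewrite x_ge0; exact: xm.
by rewrite (bigD1 m) //= lerDl sumr_ge0 // => r _; rewrite exprn_ge0.
Qed.

(** The modulus is multiplicative, so a sum of k-th powers of moduli of entries dominates the
    product. *)
Lemma cintegrable_entries : (0 < k)%N -> finite_entry_moments W k ->
  forall c e : I, cintegrable P (fun t => tensor_power (W t) c e).
Proof.
move=> k_gt0 W_mom c e.
have entry_meas a b : parts_measurable (fun t => W t a b).
  exact: (parts_measurable_comp (parts_measurable_entry R a b) (measurable_funPT W)).
apply: (@cintegrable_le _ _ _ _ _
  (fun t => \sum_r Normc.normc (W t (c r) (e r)) ^+ k)).
- by apply: parts_measurable_prod => r; exact: entry_meas.
- rewrite (_ : _ \o _ =
    (fun t => \sum_r (Normc.normc (W t (c r) (e r)) ^+ k)%:E)%E); last first.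
    by apply/funext => t /=; rewrite sumEFin.
  apply: integrable_sum => // r _; apply/integrableP; split.
    by apply/measurable_EFinP/measurable_funX/measurable_normc.
  have := W_mom (c r) (e r); rewrite unlock.
  congr (_ < _)%E; apply: eq_integral => t _.
  by rewrite /= ger0_norm // exprn_ge0 //; case: (W t _ _) => ? ?; exact: sqrtr_ge0.
- move=> t; rewrite /tensor_power.
  rewrite (big_morph _ (@Normc.normcM R) (@Normc.normc1 R)).
  by apply: prod_le_sum_exp => // r; case: (W t _ _) => ? ?; exact: sqrtr_ge0.
Qed.

(** Both expectations are integrals of the parts of [F] against image measures, and these agree on
    measurable sets. *)
Lemma eq_cexpectation_distribution (phi : T -> 'M[C]_n) (F : 'M[C]_n -> C) :
  measurable_fun setT phi ->
  (forall A, measurable A -> pushforward P phi A = distribution P W A) ->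
  parts_measurable F -> cintegrable P (F \o phi) -> cintegrable P (F \o W) ->
  cexpectation P (F \o phi) = cexpectation P (F \o W).
Proof.
move=> mphi phiW [Fr Fi] [phir phii] [Wr Wi].
have key (G : 'M[C]_n -> R) : measurable_fun setT G ->
    P.-integrable setT (EFin \o (G \o phi)) ->
    P.-integrable setT (EFin \o (G \o W)) ->
    (\int[P]_t (G (phi t))%:E = \int[P]_t (G (W t))%:E)%E.
  move=> mG Gphi GW.
  have mEG : measurable_fun setT (EFin \o G) by exact/measurable_EFinP.
  have <- := integral_pushforward mphi mEG Gphi measurableT.
  have <- := integral_distribution mEG GW.
  by apply: eq_measure_integral => A mA _; exact: phiW.
by rewrite /cexpectation unlock (key _ Fr) // (key _ Fi).
Qed.

Lemma tensor_power1 : kernel_mx (tensor_power (1%:M : 'M[C]_n)) =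
  1%:M :> 'M[C]_#|{: I}|.
Proof.
have -> : 1%:M = diag_mx (\row_(l < n) (1 : C)).
  by apply/matrixP => x y; rewrite !mxE.
apply/matrixP => a b; rewrite !mxE tensor_power_diag.
by rewrite prodr_const expr1n mulr1 (inj_eq enum_val_inj).
Qed.

Definition moment_kernel (a b : I) : C :=
  cexpectation P (fun t => tensor_power (W t) a b).

Hypothesis k_gt0 : (0 < k)%N.
Hypothesis W_mom : finite_entry_moments W k.

(** Multiplicativity of [tensor_power] gives a finite combination of entries of the tensor power of
    [W t] with constant coefficients. *)
Lemma moment_kernel_conj (U V : 'M[C]_n) (a b : I) :
  cintegrable P (fun t => tensor_power (U *m W t *m V) a b) /\
  cexpectation P (fun t => tensor_power (U *m W t *m V) a b) =
  \sum_e (\sum_c tensor_power U a c * moment_kernel c e) * tensor_power V e b.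
Proof.
have Wint := cintegrable_entries k_gt0 W_mom.
rewrite (_ : (fun t => _) = fun t => \sum_(p : I * I)
    (tensor_power U a p.1 * tensor_power V p.2 b) * tensor_power (W t) p.1 p.2).
  have [] := cintegrable_sum (index_enum (I * I)%type)
    (fun p => tensor_power U a p.1 * tensor_power V p.2 b)
    (fun p : I * I => Wint p.1 p.2).
  move=> int ->; split=> //.
  rewrite -(pair_bigA _ (fun c e => tensor_power U a c * tensor_power V e b *
    moment_kernel c e)) exchange_big; apply: eq_bigr => e _ /=.
  by rewrite mulr_suml; apply: eq_bigr => c _; rewrite mulrAC.
apply/funext => t; rewrite tensor_powerME.
rewrite -(pair_bigA _ (fun c e => tensor_power U a c * tensor_power V e b *
  tensor_power (W t) c e)) exchange_big; apply: eq_bigr => e _ /=.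
by rewrite tensor_powerME mulr_suml; apply: eq_bigr => c _; rewrite mulrAC.
Qed.

(** Invariance in law equates the moment kernel with its conjugate by the tensor power of [U];
    multiplying by that power on the right cancels the adjoint. *)
Lemma moment_kernel_comm : unitarily_invariant W ->
  forall U, U \is unitarymx ->
  comm_mx (kernel_mx moment_kernel) (kernel_mx (tensor_power U)).
Proof.
move=> W_inv U Uunit.
have kernelE : kernel_mx moment_kernel = kernel_mx (tensor_power U) *m
    kernel_mx moment_kernel *m kernel_mx (tensor_power (U^t*)).
  rewrite !kernel_mxM; apply/matrixP => x y; rewrite !mxE.
  have [int <-] := moment_kernel_conj U (U^t*) (enum_val x) (enum_val y).
  apply/esym/(@eq_cexpectation_distribution (fun t => U *m W t *m U^t*)
    (fun M => tensor_power M (enum_val x) (enum_val y))) => //.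
  - apply: mx_measurable_entries => u v; under eq_fun do rewrite mxE.
    apply: parts_measurable_sum => l.
    apply: parts_measurableM; last exact: parts_measurable_cst.
    under eq_fun do rewrite mxE.
    apply: parts_measurable_sum => m.
    apply: parts_measurableM; first exact: parts_measurable_cst.
    exact: (parts_measurable_comp (parts_measurable_entry R m l) (measurable_funPT W)).
  - exact: W_inv.
  - by apply: parts_measurable_prod => r; exact: parts_measurable_entry.
  - exact: cintegrable_entries.
rewrite /comm_mx {1}kernelE -mulmxA -tensor_powerM.
by rewrite (mulmx1C (unitarymxP Uunit)) tensor_power1 mulmx1.
Qed.

End InvariantMoments.

Theorem theorem3p1 (R : realType) (d : measure_display) (T : measurableType d)
    (P : probability T R) (n k : nat) (hn : (0 < n)%N) (hk : (0 < k)%N)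
    (W : {RV P >-> 'M[R[i]]_n})
    (W_herm : forall t, W t \is hermsymmx)
    (W_inv : unitarily_invariant W)
    (W_mom : finite_entry_moments W k)
    (i j : 'I_k -> 'I_n) :
  cexpectation P (fun t => \prod_(r < k) W t (i r) (j r)) =
  \sum_(sigma : 'S_k) \sum_(tau : 'S_k)
    delta_perm R sigma i j * WgU k n%:R (tau * sigma^-1)%g *
    cexpectation P (fun t => Tr_perm tau (W t)).
Proof.
transitivity (moment_kernel W (finfun i) (finfun j)).
  congr cexpectation; apply/funext => t.
  by apply: eq_bigr => r _; rewrite !ffunE.
rewrite (unitary_commutant_expansion hn (moment_kernel_comm hk W_mom W_inv)).
apply: eq_bigr => sigma _; apply: eq_bigr => tau _.
congr (_ * _ * _).
  rewrite -delta_permE; apply: eq_bigr => r _; by rewrite !ffunE.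
have Wint := cintegrable_entries hk W_mom.
(* Linearity with all weights 1 exchanges the expectation with the sum over [c] that expresses
   [Tr_perm tau]. *)
have [_] := cintegrable_sum (index_enum {ffun 'I_k -> 'I_n}) (fun=> 1)
  (fun c => Wint c [ffun r => c (tau r)]).
under [RHS]eq_bigr do rewrite mul1r.
move=> <-; congr cexpectation; apply/funext => t; rewrite Tr_permE //.
apply: eq_bigr => c _; rewrite mul1r; apply: eq_bigr => r _.
by rewrite ffunE.
Qed.
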